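(* Let $X$ be a Banach space, let $(e_n)_{n\in\mathbb{N}}\subset X$ be a normalized basic sequence and let $Y$ be the closed linear span of $(e_n)_n$. Let $T\in\mathscr{B}_{seq}(X,Y)$ be an operator with associated sequences $(f_n,x_n)_n\subset X^*\times X$, and let $\mathscr{B}\subset\mathscr{B}_{seq}(X,Y)\cap\mathscr{S}_\infty(X,Y)$ be a non-empty family. Assume that $$\inf_{k\in\mathbb{N}}\frac{c_k(R)\,d_k(T)}{k}=0\qquad\text{for every } R\in\mathscr{B}.$$ Then $\|T-Q\|\geq 1/d$ for every $Q$ in the closed operator ideal $I(\mathscr{B})$ generated by $\mathscr{B}$, where $d:=\sup_n\|x_n\|$.
   Context: Banach spaces are real; $\mathbb{N}=\{1,2,\dots\}$. $\mathscr{B}(X)$ is the algebra of bounded linear operators on $X$; $B_{X^*}$ is the closed unit ball of $X^*$. A sequence is seminormalized if its norms are bounded above and bounded away from $0$. $(e_n^* )_n\subset Y^*$ denotes the functionals biorthogonal to the basis $(e_n)_n$ of $Y$. $\mathscr{B}_{seq}(X,Y)\subset\mathscr{B}(X)$ is the family of bounded operators on $X$ of the form $T:X\ni x\mapsto\sum_{n=1}^\infty f_n(x)e_n\in Y\subset X$ for some biorthogonal basic sequences $(f_n,x_n)_{n\in\mathbb{N}}\subset X^*\times X$ (i.e. $(f_n)_n$ and $(x_n)_n$ are basic sequences with $f_n(x_m)=\delta_{nm}$), with $(f_n)_n\subset B_{X^*}$ weakly$^*$ null and $(x_n)_n$ seminormalized. Every operator in $\mathscr{B}_{seq}(X,Y)$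 is always considered together with fixed such sequences $(f_n,x_n)_n$, called associated to it. For $T\in\mathscr{B}_{seq}(X,Y)$ with associated sequences $(f_n,x_n)_n$ and $k\in\mathbb{N}$ put $$c_k(T)=\limsup_{i_1<\dots<i_k,\ i_1,\dots,i_k\to\infty}\ \sup\{\|\epsilon_1f_{i_1}+\dots+\epsilon_kf_{i_k}\|:\epsilon_1=\pm1,\dots,\epsilon_k=\pm1\},$$ $$d_k(T)=\limsup_{i_1<\dots<i_k,\ i_1,\dots,i_k\to\infty}\|x_{i_1}+\dots+x_{i_k}\|,$$ where $\limsup_{i_1<\dots<i_k,\ i_1,\dots,i_k\to\infty}a(i_1,\dots,i_k)=\lim_{p\to\infty}\sup_{p\le i_1<\dots<i_k}a(i_1,\dots,i_k)$. $\mathscr{S}_\infty(X,Y)$ is the family of bounded operators $T:X\to Y$ such that for every bounded sequence $(y_m)_m\subset X$ with $\|Ty_m\|_{Y,\infty}\to0$ one also has $\|Ty_m\|\to0$, where $\|y\|_{Y,\infty}=\sup_n|e_n^*(y)|$ for $y\in Y$. For $\mathscr{B}\subset\mathscr{B}(X)$, $I(\mathscr{B})$ is the closed operator ideal generated by $\mathscr{B}$, i.e. the operator-norm closure of $\{\sum_{j=1}^lQ_j\circ R_j\circ S_j: Q_j,S_j\in\mathscr{B}(X),\ R_j\in\mathscr{B},\ j=1,\dots,l,\ l\in\mathbb{N}\}$. *)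

(* Defs.v *)
From HB Require Import structures.
From mathcomp Require Import all_boot all_order all_algebra.
From mathcomp Require Import all_classical all_reals all_analysis.

Set Implicit Arguments.
Unset Strict Implicit.
Unset Printing Implicit Defensive.

Import Order.TTheory GRing.Theory Num.Theory.
Import numFieldNormedType.Exports.

Local Open Scope classical_set_scope.
Local Open Scope ring_scope.

Record boundedOp (R : realType) (V W : normedModType R) := BoundedOp {
  bop_fun :> V -> W ;
  bop_linear : linear bop_fun ;
  bop_bounded : bounded_fun_norm bop_fun }.

Section BoundedOp.
Context {R : realType} {V W : normedModType R}.
Local Notation L := (boundedOp V W).

HB.instance Definition _ (T : L) :=
  GRing.isLinear.Build R V W *:%R (bop_fun T) (bop_linear T).

Lemma bop_eq (S T : L) : S =1 T -> S = T.
Proof.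
case: S T => [f lf bf] [g lg bg] /= /funext fg; case: _ / fg in lg bg *.
by rewrite (Prop_irrelevance lf lg) (Prop_irrelevance bf bg).
Qed.

HB.instance Definition _ := gen_eqMixin L.
HB.instance Definition _ := gen_choiceMixin L.

Fact bop_zero_linear : linear (fun _ : V => 0 : W).
Proof. by move=> a u v; rewrite scaler0 addr0. Qed.

Fact bop_zero_bounded : bounded_fun_norm (fun _ : V => 0 : W).
Proof. by move=> r; exists 0 => x _; rewrite normr0. Qed.

Definition bop_zero : L := BoundedOp bop_zero_linear bop_zero_bounded.

Fact bop_add_linear (S T : L) : linear (fun x => S x + T x).
Proof. by move=> a u v; rewrite !linearP scalerDr addrACA. Qed.

Fact bop_add_bounded (S T : L) : bounded_fun_norm (fun x => S x + T x).
Proof.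
move=> r; have [M SM] := bop_bounded S r; have [N TN] := bop_bounded T r.
by exists (M + N) => x xr; rewrite (le_trans (ler_normD _ _)) ?lerD ?SM ?TN.
Qed.

Definition bop_add (S T : L) : L :=
  BoundedOp (bop_add_linear S T) (bop_add_bounded S T).

Fact bop_scale_linear (c : R) (T : L) : linear (fun x => c *: T x).
Proof. by move=> a u v; rewrite linearP scalerDr !scalerA mulrC. Qed.

Fact bop_scale_bounded (c : R) (T : L) : bounded_fun_norm (fun x => c *: T x).
Proof.
move=> r; have [M TM] := bop_bounded T r.
by exists (`|c| * M) => x xr; rewrite normrZ ler_wpM2l ?TM.
Qed.

Definition bop_scale (c : R) (T : L) : L :=
  BoundedOp (bop_scale_linear c T) (bop_scale_bounded c T).

Fact bop_addA : associative bop_add.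
Proof. by move=> S T U; apply: bop_eq => x /=; rewrite addrA. Qed.

Fact bop_addC : commutative bop_add.
Proof. by move=> S T; apply: bop_eq => x /=; rewrite addrC. Qed.

Fact bop_add0 : left_id bop_zero bop_add.
Proof. by move=> T; apply: bop_eq => x /=; rewrite add0r. Qed.

Fact bop_addN : left_inverse bop_zero (bop_scale (-1)) bop_add.
Proof. by move=> T; apply: bop_eq => x /=; rewrite scaleN1r addNr. Qed.

HB.instance Definition _ :=
  GRing.isZmodule.Build L bop_addA bop_addC bop_add0 bop_addN.

Fact bop_scaleA (a b : R) (T : L) :
  bop_scale a (bop_scale b T) = bop_scale (a * b) T.
Proof. by apply: bop_eq => x /=; rewrite scalerA. Qed.

Fact bop_scale1 : left_id 1 bop_scale.
Proof. by move=> T; apply: bop_eq => x /=; rewrite scale1r. Qed.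

Fact bop_scaleDr : right_distributive bop_scale +%R.
Proof. by move=> a S T; apply: bop_eq => x /=; rewrite scalerDr. Qed.

Fact bop_scaleDl (T : L) : {morph bop_scale^~ T : a b / a + b}.
Proof. by move=> a b; apply: bop_eq => x /=; rewrite scalerDl. Qed.

HB.instance Definition _ := GRing.Zmodule_isLmodule.Build R L
  bop_scaleA bop_scale1 bop_scaleDr bop_scaleDl.

Definition opnorm (T : L) : R := sup [set `|T x| | x in [set x | `|x| <= 1]].

Lemma opnorm_has_sup (T : L) : has_sup [set `|T x| | x in [set x | `|x| <= 1]].
Proof.
split; first by exists `|T 0|, 0 => //=; rewrite normr0.
by have [M TM] := bop_bounded T 1; exists M => _ [x /= x1 <-]; apply: TM.
Qed.

Lemma opnorm_ub1 (T : L) (x : V) : `|x| <= 1 -> `|T x| <= opnorm T.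
Proof. by move=> x1; apply: (sup_upper_bound (opnorm_has_sup T)); exists x. Qed.

Lemma opnorm_le (T : L) (M : R) :
  (forall x, `|x| <= 1 -> `|T x| <= M) -> opnorm T <= M.
Proof.
move=> TM; apply: ge_sup; first by case: (opnorm_has_sup T).
by move=> _ [x /= x1 <-]; apply: TM.
Qed.

Lemma opnorm_ge0 (T : L) : 0 <= opnorm T.
Proof. by rewrite (le_trans (normr_ge0 (T 0))) ?opnorm_ub1 ?normr0. Qed.

Lemma opnorm_ub (T : L) (x : V) : `|T x| <= opnorm T * `|x|.
Proof.
have [->|x0] := eqVneq x 0; first by rewrite linear0 !normr0 mulr0.
rewrite -ler_pdivrMr ?normr_gt0// mulrC -[X in X * _]ger0_norm ?invr_ge0//.
rewrite -normrZ -linearZ opnorm_ub1// normrZ ger0_norm ?invr_ge0//.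
by rewrite mulVf ?normr_eq0.
Qed.

Fact opnormD (S T : L) : opnorm (S + T) <= opnorm S + opnorm T.
Proof.
apply: opnorm_le => x x1; rewrite (le_trans (ler_normD (S x) (T x)))//.
by rewrite lerD ?opnorm_ub1.
Qed.

Fact opnormZ (c : R) (T : L) : opnorm (c *: T) = `|c| * opnorm T.
Proof.
have le_cT d (U : L) : opnorm (d *: U) <= `|d| * opnorm U.
  apply: opnorm_le => x x1; rewrite [X in X <= _](normrZ d (U x)).
  by rewrite ler_wpM2l ?opnorm_ub1.
apply/eqP; rewrite eq_le le_cT /=; have [->|c0] := eqVneq c 0.
  by rewrite normr0 mul0r opnorm_ge0.
rewrite -ler_pdivlMl ?normr_gt0// -normfV.
by rewrite (le_trans _ (le_cT _ _))// scalerA mulVf// scale1r.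
Qed.

Fact opnorm0_eq0 (T : L) : opnorm T = 0 -> T = 0.
Proof.
move=> T0; apply: bop_eq => x; apply/eqP; rewrite -normr_le0.
by have := opnorm_ub T x; rewrite T0 mul0r.
Qed.

HB.instance Definition _ :=
  Lmodule_isNormed.Build R L opnormD opnormZ opnorm0_eq0.

End BoundedOp.

Definition dual (R : realType) (X : normedModType R) : normedModType R :=
  boundedOp X R^o.

Section Comp.
Context {R : realType} {U V W : normedModType R}.

Fact bop_comp_linear (S : boundedOp V W) (T : boundedOp U V) :
  linear (S \o T).
Proof. by move=> a u v /=; rewrite !linearP. Qed.

Fact bop_comp_bounded (S : boundedOp V W) (T : boundedOp U V) :
  bounded_fun_norm (S \o T).
Proof.
move=> r; have [M TM] := bop_bounded T r; have [N SN] := bop_bounded S M.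
by exists N => x xr; apply/SN/TM.
Qed.

Definition bop_comp (S : boundedOp V W) (T : boundedOp U V) : boundedOp U W :=
  BoundedOp (bop_comp_linear S T) (bop_comp_bounded S T).

End Comp.

(* Sequences indexed by {1, 2, ...} are indexed here by nat = {0, 1, ...}. *)
Section Sequences.
Context {R : realType} {V : normedModType R}.

Definition linear_span (u : nat -> V) : set V :=
  [set y | exists (n : nat) (a : nat -> R), y = \sum_(i < n) a i *: u i].

Definition closed_span (u : nat -> V) : set V := closure (linear_span u).

Definition basic_sequence (u : nat -> V) : Prop :=
  forall y, closed_span u y ->
    exists! a : nat -> R, series (fun n => a n *: u n) @ \oo --> y.

Definition normalized (u : nat -> V) : Prop := forall n, `|u n| = 1.

Definition seminormalized (u : nat -> V) : Prop :=
  exists m M : R, 0 < m /\ forall n, m <= `|u n| <= M.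

End Sequences.

Definition weak_star_null (R : realType) (X : normedModType R)
    (f : nat -> dual X) : Prop :=
  forall z : X, (fun n => f n z : R) @ \oo --> (0 : R).

(* limsup of a(i_1, ..., i_k) over i_1 < ... < i_k with all i_j -> oo, meant for
   k > 0 and bounded a, for which the [sup] and the limit in R are genuine. *)
Definition limsup_incr (R : realType) (k : nat) (a : ('I_k -> nat) -> R) : R :=
  limn (fun p : nat => sup [set a i | i in [set i : 'I_k -> nat |
    (forall j, (p <= i j)%N) /\
    (forall j l : 'I_k, (j < l)%N -> (i j < i l)%N)]]).

Section Operators.
Context {R : realType} {X : completeNormedModType R}.

Definition associated (e : nat -> X) (T : boundedOp X X)
    (f : nat -> dual X) (x : nat -> X) : Prop :=
  [/\ basic_sequence f /\ basic_sequence x,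
      forall n m, f n (x m) = (n == m)%:R,
      (forall n, `|f n| <= 1) /\ weak_star_null f,
      seminormalized x
    & forall z, series (fun n => (f n z : R) *: e n) @ \oo --> T z].

(* An element of B_seq(X, Y), Y the closed span of e, bundled with its fixed
   associated sequences, on which c_k and d_k depend. *)
Record seqOp (e : nat -> X) := SeqOp {
  seq_op :> boundedOp X X ;
  seq_f : nat -> dual X ;
  seq_x : nat -> X ;
  seq_assoc : associated e seq_op seq_f seq_x }.

Definition c_ (e : nat -> X) (k : nat) (T : seqOp e) : R :=
  limsup_incr (fun i : 'I_k -> nat =>
    sup [set `|\sum_(j < k) eps j *: seq_f T (i j)| | eps in
      [set eps : 'I_k -> R | forall j, eps j = 1 \/ eps j = -1]]).

Definition d_ (e : nat -> X) (k : nat) (T : seqOp e) : R :=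
  limsup_incr (fun i : 'I_k -> nat => `|\sum_(j < k) seq_x T (i j)|).

(* The biorthogonal functionals are elements of Y^*, Y the closed span of e:
   they are maps on X of which only the values on Y are relevant. *)
Definition biorthogonal_functionals (e : nat -> X) (es : nat -> X -> R) : Prop :=
  forall n,
  [/\ forall (a : R) (u v : X), closed_span e u -> closed_span e v ->
        es n (a *: u + v) = a * es n u + es n v,
      exists M : R, forall y, closed_span e y -> `|es n y| <= M * `|y|
    & forall m, es n (e m) = (n == m)%:R].

(* For y in Y the set below is bounded, so that [sup] is its true supremum. *)
Definition norm_infty (es : nat -> X -> R) (y : X) : R :=
  sup (range (fun n => `|es n y|)).

Definition S_infty (e : nat -> X) (es : nat -> X -> R) : set (boundedOp X X) :=
  [set T | (forall z, closed_span e (T z)) /\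
    forall y : nat -> X, (exists M : R, forall m, `|y m| <= M) ->
      (fun m => norm_infty es (T (y m))) @ \oo --> (0 : R) ->
      (fun m => `|T (y m)|) @ \oo --> (0 : R)].

Definition closed_ideal (B : set (boundedOp X X)) : set (boundedOp X X) :=
  closure [set P | exists (l : nat) (Q A S : 'I_l -> boundedOp X X),
    [/\ (0 < l)%N, forall j, B (A j)
      & P = \sum_(j < l) bop_comp (Q j) (bop_comp (A j) (S j))]].

End Operators.

(* Main.v *)
Require Import Defs.
From mathcomp Require Import all_boot all_order all_algebra.
From mathcomp Require Import all_classical all_reals all_analysis.
From mathcomp Require Import ring lra.

Set Implicit Arguments.
Unset Strict Implicit.
Unset Printing Implicit Defensive.

Import Order.TTheory GRing.Theory Num.Theory.
Import numFieldNormedType.Exports.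
Local Open Scope classical_set_scope.
Local Open Scope ring_scope.

(** Write [x n] for the vectors associated with [T], so that [T (x n) = e n].
    If [P (x n)] tends to 0 for an operator [P], then
    [1 = |e n| <= |T - P| * |x n| + |P (x n)|] gives [1 <= |T - P| * d] in the
    limit.  By continuity of the norm in [P] it thus suffices to have this for
    the finite sums of operators [Q A S] with [A] in [B], and so to show that
    [A (S (x n))] tends to 0 for every bounded [S] ([seqOp_comp_null]).

    Since [A] belongs to S_infty, the convergence only needs to be checked
    coordinatewise and uniformly: with [f m] the functionals associated with
    [A], the claim is that [f m (S (x n))] tends to 0 as [n] grows, uniformly
    in [m] ([negligible_product_uniform]).  This is where the hypothesis on
    [c_k d_k / k] comes in.

    - The sequence [x] is weakly null: if [g (x n) >= eps] infinitely often,
      then sums of [k] of these vectors have norm at least [k * eps / |g|],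
      while [c_k] stays away from 0 because [f m] takes the value 1 at a vector
      of bounded norm; hence [c_k d_k / k] is bounded below.
    - Suppose that, for arbitrarily large [n], [|f m (S (x n))| >= delta] for
      some [m] depending on [n].  Weak nullity of [x] forces [m] to be large too,
      and together with weak* nullity of [f] it allows one to choose, far out,
      [m_1 < ... < m_k] and [n_1 < ... < n_k] for which the matrix
      [f m_s (S (x n_t))] has diagonal entries at least [delta] in modulus and
      off-diagonal ones at most [delta / (2 k)].  Testing
      [\sum_s eps_s f m_s], for the right signs, on [S (\sum_t x n_t)] yields
      [k * delta / 2 <= c_k * |S| * d_k] in the limit, so that [c_k d_k / k] is
      again bounded below by a positive constant. *)

(** * Finite subsequences with pairwise constraints *)

Lemma not_near_infty (P : nat -> Prop) :
  ~ (\forall n \near \oo, P n) -> forall N, exists2 n, (N <= n)%N & ~ P n.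
Proof.
move=> nP N; apply: contrapT => nN; apply: nP; exists N => // n /= Nn.
by apply: contrapT => nPn; apply: nN; exists n.
Qed.

(** The sliding hump selection: as each point constrains only the points that
    are not far enough out, points of [P] can be picked one after the other. *)
Lemma has_pairwise_fun (Z : eqType) (large : nat -> pred Z)
    (P : pred Z) (C : rel Z) :
    (forall M N z, (M <= N)%N -> large N z -> large M z) ->
    (forall z, exists N, forall z', large N z' -> C z z') ->
    (forall N, exists2 z, P z & large N z) ->
  forall k, exists i : 'I_k -> Z,
    (forall s, P (i s)) /\ (forall s t : 'I_k, (s < t)%N -> C (i s) (i t)).
Proof.
move=> large_mono Clarge Plarge k.
suff [s [sk Ps Cs]] : exists s : seq Z, [/\ size s = k, all P s & pairwise C s].
  have [z0 _ _] := Plarge 0%N; exists (nth z0 s); split=> [i|i j ij].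
    by apply: (allP Ps); rewrite mem_nth ?sk.
  by apply: (pairwiseP z0 Cs); rewrite ?inE ?sk.
elim: k => [|k [s [sk Ps Cs]]]; first by exists [::].
have [N CN] : exists N, forall z, large N z -> all (C^~ z) s.
  elim: s {sk Ps Cs} => [|y s [N CN]]; first by exists 0%N.
  have [N' CN'] := Clarge y; exists (maxn N N') => z zN /=.
  by rewrite CN' ?CN// (large_mono _ _ _ _ zN) ?leq_maxl ?leq_maxr.
have [z Pz zN] := Plarge N; exists (rcons s z); split.
- by rewrite size_rcons sk.
- by rewrite all_rcons Pz.
- by rewrite pairwise_rcons Cs CN.
Qed.

(** * The limit superior over increasing tuples *)

Definition tail_incr {k : nat} (p : nat) : set ('I_k -> nat) :=
  [set i | (forall j, (p <= i j)%N) /\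
           (forall j l : 'I_k, (j < l)%N -> (i j < i l)%N)].

Section LimsupIncr.
Context {R : realType} {k : nat}.
Implicit Types (a b : ('I_k -> nat) -> R) (M L : R) (p : nat).

Lemma tail_incr_has_sup a M p :
  (forall i, 0 <= a i <= M) -> has_sup (a @` tail_incr p).
Proof.
move=> aM; split; last by exists M => _ [i _ <-]; have /andP[] := aM i.
exists (a (fun j => p + j)%N), (fun j => p + j)%N => //.
by split=> [j|j l jl]; rewrite ?leq_addr ?ltn_add2l.
Qed.

Lemma tail_incr_sup_ge0 a M p :
  (forall i, 0 <= a i <= M) -> 0 <= sup (a @` tail_incr p).
Proof.
move=> aM; have [[_ [i ip _]] ub] := tail_incr_has_sup p aM.
have /andP[ai0 _] := aM i; apply: le_trans ai0 _.
by apply: (ub_le_sup ub); exists i.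
Qed.

Lemma cvg_limsup_incr a M : (forall i, 0 <= a i <= M) ->
  (fun p => sup (a @` tail_incr p)) @ \oo --> limsup_incr a.
Proof.
move=> aM; apply: nonincreasing_is_cvgn.
- move=> p q pq; apply: sup_le.
  + move=> _ [i [iq ii] <-]; apply/downP; exists (a i) => //; exists i => //.
    by split=> // j; apply: leq_trans pq (iq j).
  + by have [] := tail_incr_has_sup q aM.
  + exact: tail_incr_has_sup aM.
- by exists 0 => _ [p _ <-]; apply: tail_incr_sup_ge0 aM.
Qed.

(** The tuples witnessing the bound may differ for [a] and [b]: the product of
    the two suprema over each tail dominates [L], and both converge. *)
Lemma limsup_incr_mul_ge a b M L :
    (forall i, 0 <= a i <= M) -> (forall i, 0 <= b i <= M) ->
    (forall p, exists i j,
      [/\ tail_incr p i, tail_incr p j & L <= a i * b j]) ->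
  L <= limsup_incr a * limsup_incr b.
Proof.
move=> aM bM ab.
have cvg_ab := cvgM (cvg_limsup_incr aM) (cvg_limsup_incr bM).
rewrite -(cvg_lim _ (cvg_ab _))//; apply: limr_ge; first exact: cvgP (cvg_ab _).
near=> p => /=; have [i [j [ip jp /le_trans]]] := ab p; apply.
have /andP[ai0 _] := aM i; have /andP[bj0 _] := bM j.
by apply: ler_pM => //; apply: ub_le_sup; try (by exists i); try (by exists j);
  case: (tail_incr_has_sup p aM) => _; case: (tail_incr_has_sup p bM).
Unshelve. all: by end_near. Qed.

End LimsupIncr.

(** * Diagonally dominant matrices *)

Section Matrix.
Context {R : realType}.

(** The sign of [a] with value 1 at 0, so that it is always an admissible
    choice of sign, unlike [Num.sg a]. *)
Definition sgn1 (a : R) : R := if 0 <= a then 1 else -1.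

Lemma sgn1P a : sgn1 a = 1 \/ sgn1 a = -1.
Proof. by rewrite /sgn1; case: ifP; [left|right]. Qed.

Lemma sgn1_mul a : sgn1 a * a = `|a|.
Proof.
rewrite /sgn1; case: ifPn => [a0|]; first by rewrite mul1r ger0_norm.
by rewrite -ltNge => a0; rewrite mulN1r ltr0_norm.
Qed.

Lemma norm_sgn1 a : `|sgn1 a| = 1.
Proof. by case: (sgn1P a) => ->; rewrite ?normrN normr1. Qed.

(** In each row the signed diagonal entry contributes at least [delta], and the
    fewer than [k] other entries take away at most [delta / 2] altogether. *)
Lemma diag_dominant_sum_ge k (a : 'I_k -> 'I_k -> R) (delta : R) :
    0 <= delta -> (forall s, delta <= `|a s s|) ->
    (forall s t, s != t -> `|a s t| <= delta / (2 * k%:R)) ->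
  delta / 2 * k%:R <= \sum_s \sum_t sgn1 (a s s) * a s t.
Proof.
move=> d0 diag off.
have -> : delta / 2 * k%:R = \sum_(s < k) delta / 2.
  by rewrite sumr_const card_ord mulr_natr.
apply: ler_sum => s _; rewrite (bigD1 s)//= sgn1_mul.
have off_sum : - \sum_(t < k | t != s) sgn1 (a s s) * a s t <= delta / 2.
  rewrite -sumrN (@le_trans _ _ (\sum_(t < k) delta / (2 * k%:R)))//.
    rewrite big_mkcond; apply: ler_sum => t _; case: ifPn => [ts|_].
      rewrite (le_trans (ler_norm _))// normrN normrM norm_sgn1 mul1r.
      by rewrite off// eq_sym.
    by rewrite divr_ge0// mulr_ge0.
  have k0 : k%:R != 0 :> R.
    by rewrite pnatr_eq0; case: k s {a diag off} => [[]|].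
  rewrite sumr_const card_ord -[X in X <= _]mulr_natr.
  by have -> : delta / (2 * k%:R) * k%:R = delta / 2 by field.
by move: (diag s) off_sum; lra.
Qed.

End Matrix.

(** * Signed sums of functionals and sums of vectors *)

Lemma bop_sumE (R : realType) (V W : normedModType R) (I : finType)
    (F : I -> boundedOp V W) (z : V) :
  (\sum_i F i) z = \sum_i F i z.
Proof. exact: (big_morph (fun S : boundedOp V W => S z)). Qed.

Section SignSup.
Context {R : realType} {X : completeNormedModType R}.
Implicit Types (f : nat -> dual X) (x : nat -> X).

Definition sign_sup k f (i : 'I_k -> nat) : R :=
  sup [set `|\sum_(j < k) eps j *: f (i j)| | eps in
    [set eps : 'I_k -> R | forall j, eps j = 1 \/ eps j = -1]].

Definition sum_norm k x (i : 'I_k -> nat) : R := `|\sum_(j < k) x (i j)|.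

Lemma sum_norm_bound k x M (i : 'I_k -> nat) :
  (forall n, `|x n| <= M) -> 0 <= sum_norm x i <= k%:R * M.
Proof.
move=> xM; rewrite normr_ge0 /= (le_trans (ler_norm_sum _ _ _))//.
rewrite (@le_trans _ _ (\sum_(j < k) M)) ?ler_sum//.
by rewrite sumr_const card_ord mulr_natl.
Qed.

Variables (f : nat -> dual X) (f1 : forall n, `|f n| <= 1).

Lemma signed_sum_norm_bound k (i : 'I_k -> nat) (eps : 'I_k -> R) :
    (forall j, eps j = 1 \/ eps j = -1) ->
  `|\sum_(j < k) eps j *: f (i j)| <= k%:R.
Proof.
move=> eps1; rewrite (le_trans (ler_norm_sum _ _ _))//.
rewrite (@le_trans _ _ (\sum_(j < k) 1))//; last first.
  by rewrite sumr_const card_ord.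
apply: ler_sum => j _; rewrite normrZ.
by case: (eps1 j) => ->; rewrite ?normrN normr1 mul1r.
Qed.

Lemma sign_sup_ub k (i : 'I_k -> nat) (eps : 'I_k -> R) :
    (forall j, eps j = 1 \/ eps j = -1) ->
  `|\sum_(j < k) eps j *: f (i j)| <= sign_sup f i.
Proof.
move=> eps1; apply: ub_le_sup; last by exists eps.
by exists k%:R => _ [eps' eps'1 <-]; apply: signed_sum_norm_bound.
Qed.

Lemma sign_sup_bound k (i : 'I_k -> nat) : 0 <= sign_sup f i <= k%:R.
Proof.
have one1 (j : 'I_k) : 1 = 1 :> R \/ 1 = -1 :> R by left.
rewrite (le_trans _ (sign_sup_ub i one1))//=.
apply: ge_sup; first by exists `|\sum_(j < k) 1 *: f (i j)|, (fun=> 1).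
by move=> _ [eps eps1 <-]; apply: signed_sum_norm_bound.
Qed.

End SignSup.

Section SeqOp.
Context {R : realType} {X : completeNormedModType R} {e : nat -> X}.
Implicit Types A T : seqOp e.

Lemma seq_f_le1 A n : `|seq_f A n| <= 1.
Proof. by have [_ _ [f1 _] _ _] := seq_assoc A. Qed.

Lemma seq_f_null A (z : X) : (fun n => seq_f A n z : R) @ \oo --> (0 : R).
Proof. by have [_ _ [_ f0] _ _] := seq_assoc A; apply: f0. Qed.

Lemma seq_x_bounded T : exists2 M : R, 0 < M & forall n, `|seq_x T n| <= M.
Proof.
have [_ _ _ [m [M [m0 xM]]] _] := seq_assoc T.
exists M => [|n]; last by have /andP[] := xM n.
by have /andP[mx xM0] := xM 0%N; apply: lt_le_trans m0 (le_trans mx xM0).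
Qed.

Lemma seq_biorth A n m : seq_f A n (seq_x A m) = (n == m)%:R.
Proof. by have [_ ->] := seq_assoc A. Qed.

(** * Consequences of the smallness of the products *)

Definition negligible_product A T :=
  inf [set c_ k A * d_ k T / k%:R | k in [set k : nat | (0 < k)%N]] = 0.

(** The form in which the hypothesis on [c_k d_k / k] is contradicted: a lower
    bound linear in [k], reached on tuples arbitrarily far out. *)
Lemma negligible_productN A T L : negligible_product A T -> 0 < L ->
  ~ (forall k p, (0 < k)%N -> exists i j : 'I_k -> nat,
      [/\ tail_incr p i, tail_incr p j &
          L * k%:R <= sign_sup (seq_f A) i * sum_norm (seq_x T) j]).
Proof.
move=> AT L0 H; suff : L <= 0 by rewrite leNgt L0.
rewrite -AT; apply: lb_le_inf; first by exists (c_ 1 A * d_ 1 T / 1), 1%N.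
move=> _ [k /= k0 <-]; rewrite ler_pdivlMr ?ltr0n//.
have [M M0 xM] := seq_x_bounded T.
(* A common bound for [sign_sup], at most [k], and [sum_norm], at most [k M]. *)
apply: (@limsup_incr_mul_ge _ _ _ _ (k%:R * (M + 1))) => [i|i|p].
- have /andP[-> /le_trans->//] := sign_sup_bound (seq_f_le1 A) i.
  by rewrite ler_peMr// lerDr ltW.
- by apply: sum_norm_bound => n; rewrite (le_trans (xM n))// lerDl.
- exact: H.
Qed.

(** Evaluated at [seq_x A (i 0)], the sum of the functionals [seq_f A (i j)] is
    1 by biorthogonality. *)
Lemma sign_sup_ge A k (i : 'I_k -> nat) M : 0 < M ->
    (forall n, `|seq_x A n| <= M) -> (0 < k)%N -> injective i ->
  M^-1 <= sign_sup (seq_f A) i.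
Proof.
case: k i => // k i M0 xM _ i_inj.
have one1 (j : 'I_k.+1) : 1 = 1 :> R \/ 1 = -1 :> R by left.
rewrite (le_trans _ (sign_sup_ub (seq_f_le1 A) i one1))//.
rewrite -div1r ler_pdivrMr//.
set g := \sum_(j < _) _.
have g1 : g (seq_x A (i ord0)) = 1.
  rewrite bop_sumE (bigD1 ord0)//= big1 ?addr0 => [|j j0].
    by rewrite scale1r seq_biorth eqxx.
  by rewrite scale1r seq_biorth (inj_eq i_inj) (negbTE j0).
have := opnorm_ub g (seq_x A (i ord0)); rewrite g1 normr1 => /le_trans; apply.
by rewrite ler_wpM2l// opnorm_ge0.
Qed.

Lemma incr_inj k p (i : 'I_k -> nat) : tail_incr p i -> injective i.
Proof.
move=> [_ i_incr] s t st; apply/val_inj; case: (ltngtP s t) => // /i_incr;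
  by rewrite st ltnn.
Qed.

(** A functional that is at least [eps] on [k] of the vectors [seq_x T n] is at
    least [k * eps] on their sum, which bounds the norm of the sum below. *)
Lemma negligible_product_near_lt A T (g : dual X) (eps : R) :
  negligible_product A T -> 0 < eps ->
  \forall n \near \oo, g (seq_x T n) < eps.
Proof.
move=> AT eps0; apply: contrapT => /not_near_infty freq.
have [M M0 xM] := seq_x_bounded A.
(* The bound [|g| + 1] for the norm of [g] also serves for [g = 0]. *)
have s0 : 0 < `|g| + 1 by rewrite ltr_wpDl.
apply: (negligible_productN (L := M^-1 * (eps / (`|g| + 1))) AT).
  by rewrite mulr_gt0 ?invr_gt0 ?divr_gt0.
move=> k p k0.
have [||N|i [iP i_incr]] := @has_pairwise_fun _ (fun N n => N <= n)%N
  (fun n => (eps <= g (seq_x T n)) && (p <= n)%N) ltn _ _ _ k.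
- by move=> ? ? ?; apply: leq_trans.
- by move=> n; exists n.+1.
- have [n /[!geq_max]/andP[Nn pn] /negP] := freq (maxn N p).
  by rewrite -leNgt => gn; exists n => //; rewrite gn.
have ip : tail_incr p i by split=> [j|//]; have /andP[] := iP j.
exists i, i; split => //; rewrite -mulrA; apply: ler_pM.
- by rewrite invr_ge0 ltW.
- by rewrite mulr_ge0// divr_ge0// ltW.
- exact: sign_sup_ge (incr_inj ip).
rewrite mulrAC ler_pdivrMr//.
apply: (@le_trans _ _ (g (\sum_(j < k) seq_x T (i j)))).
  rewrite linear_sum mulr_natr -[k in _ *+ k]card_ord -sumr_const.
  by apply: ler_sum => j _; have /andP[] := iP j.
rewrite (le_trans (ler_norm _))// (le_trans (opnorm_ub _ _))// mulrC.
by rewrite ler_wpM2l ?normr_ge0// lerDl.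
Qed.

Lemma negligible_product_weakly_null A T (g : dual X) :
  negligible_product A T -> (fun n => g (seq_x T n) : R) @ \oo --> (0 : R).
Proof.
move=> AT; apply/cvgr0Pnorm_lt => eps eps0.
have g_lt := negligible_product_near_lt g AT eps0.
have := negligible_product_near_lt (- g) AT eps0.
apply: filterS2 g_lt => n g_lt ng_lt; rewrite ltr_norml g_lt andbT ltrNl.
by move: ng_lt; rewrite [X in X < _]scaleN1r.
Qed.

(** The key step: a failure of uniform convergence produces arbitrarily large
    nearly diagonal matrices [seq_f A m (S (seq_x T n))]. *)
Lemma negligible_product_uniform A T (S : boundedOp X X) (delta : R) :
  negligible_product A T -> 0 < delta ->
  \forall n \near \oo, forall m, `|seq_f A m (S (seq_x T n)) : R| < delta.
Proof.
move=> AT delta0; apply: contrapT => /not_near_infty freq.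
pose a m n : R := seq_f A m (S (seq_x T n)).
have a_row m eta : 0 < eta -> \forall n \near \oo, `|a m n| < eta.
  move=> eta0; have := @negligible_product_weakly_null A T
    (bop_comp (seq_f A m) S) AT.
  by move/cvgr0Pnorm_lt => /(_ _ eta0).
have a_col n eta : 0 < eta -> \forall m \near \oo, `|a m n| < eta.
  move=> eta0.
  by have /cvgr0Pnorm_lt/(_ _ eta0) := seq_f_null A (S (seq_x T n)).
(* The finitely many rows [m < N] are eventually small by weak nullity, so a
   large entry in a far column lies in a far row. *)
have large_diag N : exists m n, [/\ (N <= m)%N, (N <= n)%N & delta <= `|a m n|].
  have [N' _ rowsN] : \forall n \near \oo, forall m : 'I_N, `|a m n| < delta.
    by apply: filter_forall => m; apply: a_row.
  have [n /[!geq_max]/andP[Nn N'n] /existsNP[m /negP]] := freq (maxn N N').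
  rewrite -leNgt => mn; exists m, n; split => //.
  rewrite leqNgt; apply/negP => mN.
  by have := rowsN n N'n (Ordinal mN); rewrite /= ltNge mn.
have s0 : 0 < `|S| + 1 by rewrite ltr_wpDl.
apply: (negligible_productN (L := delta / 2 / (`|S| + 1)) AT).
  by rewrite !divr_gt0.
move=> k p k0; pose eta := delta / (2 * k%:R).
have eta0 : 0 < eta by rewrite divr_gt0// mulr_gt0// ltr0n.
(* Pairs (row, column) of large entries, any two of which give small entries at
   the two crossed positions. *)
have [||N|z [zP zC]] := @has_pairwise_fun _
  (fun N (z : nat * nat) => (N <= z.1) && (N <= z.2))%N
  (fun z => [&& delta <= `|a z.1 z.2|, (p <= z.1)%N & (p <= z.2)%N])
  (fun z z' => [&& (z.1 < z'.1)%N, (z.2 < z'.2)%N, `|a z.1 z'.2| < eta &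
     `|a z'.1 z.2| < eta]) _ _ _ k.
- by move=> M N z MN /andP[z1 z2]; rewrite !(leq_trans MN).
- move=> z; have [N1 _ row] := a_row z.1 _ eta0.
  have [N2 _ col] := a_col z.2 _ eta0.
  exists (maxn (maxn N1 N2) (maxn z.1 z.2).+1) => z'.
  rewrite !geq_max !gtn_max -!andbA.
  case/and5P => _ N21 z11 _ /and4P[N12 _ _ z22].
  by rewrite z11 z22 row ?col.
- have [m [n [/[!geq_max]/andP[Nm pm] /andP[Nn pn] mn]]] :=
    large_diag (maxn N p).
  by exists (m, n); rewrite /= ?Nm ?Nn ?pm ?pn ?mn.
pose i s := (z s).1; pose j s := (z s).2.
exists i, j; split.
- split=> [s|s t /zC/and4P[]//]; by have /and3P[] := zP s.
- split=> [s|s t /zC/and4P[]//]; by have /and3P[] := zP s.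
rewrite mulrAC ler_pdivrMr//.
have := @diag_dominant_sum_ge _ k (fun s t => a (i s) (j t)) _ (ltW delta0).
move=> /(_ _ _)/le_trans; apply.
- by move=> s; have /and3P[] := zP s.
- move=> s t st; apply: ltW; move: st; rewrite neq_ltn.
  by case/orP => /zC/and4P[].
(* The signed sum of the matrix is the value of a signed sum of functionals at
   the image under [S] of a sum of vectors. *)
pose eps s := sgn1 (a (i s) (j s)).
pose g := \sum_(s < k) eps s *: seq_f A (i s).
pose y := \sum_(t < k) seq_x T (j t).
have -> : \sum_s \sum_t sgn1 (a (i s) (j s)) * a (i s) (j t) = g (S y).
  rewrite bop_sumE; apply: eq_bigr => s _.
  rewrite linear_sum [RHS]/= linear_sum -mulr_sumr.
  by [].
rewrite (le_trans (ler_norm _))// (le_trans (opnorm_ub _ _))//.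
rewrite -mulrA ler_pM ?opnorm_ge0//.
  by apply: sign_sup_ub => [|s]; [exact: seq_f_le1|exact: sgn1P].
rewrite (le_trans (opnorm_ub _ _))// mulrC ler_wpM2l// lerDl//.
Qed.

End SeqOp.

(** * Coordinates and operators in the ideal *)

Section Coordinates.
Context {R : realType} {X : completeNormedModType R} {e : nat -> X}.
Implicit Types A T : seqOp e.

Lemma seqOp_e T n : T (seq_x T n) = e n.
Proof.
have [_ _ _ _ /(_ (seq_x T n)) TE] := seq_assoc T.
apply/esym; apply: cvg_unique TE => //.
apply: cvg_near_cst; exists n.+1 => // N /= nN.
rewrite /series /= big_mkord (bigD1 (Ordinal nN))//= seq_biorth eqxx scale1r.
rewrite big1 ?addr0// => m; rewrite seq_biorth -val_eqE /=.
by move=> /negbTE ->; rewrite scale0r.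
Qed.

Variables (es : nat -> X -> R) (es_biorth : biorthogonal_functionals e es).

Lemma es_sum n N (c : nat -> R) : (n < N)%N ->
  es n (\sum_(m < N) c m *: e m) = c n.
Proof.
have [es_lin _ es_e] := es_biorth n.
have span M : closed_span e (\sum_(m < M) c m *: e m).
  by apply: subset_closure; exists M, c.
have es0 : es n 0 = 0.
  have := es_lin 1 0 0; rewrite scale1r addr0 mul1r.
  have -> : 0 = \sum_(m < 0) c m *: e m by rewrite big_ord0.
  move=> /(_ (span 0%N) (span 0%N)) /eqP.
  by rewrite -subr_eq subrr eq_sym => /eqP.
have e_span m : closed_span e (e m).
  apply: subset_closure; exists m.+1, (fun l => (l == m)%:R).
  rewrite big_ord_recr /= eqxx scale1r big1 ?add0r// => l _.
  by rewrite ltn_eqF// scale0r.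
have sumE M : es n (\sum_(m < M) c m *: e m) = \sum_(m < M) c m * (n == m)%:R.
  elim: M => [|M IH]; first by rewrite !big_ord0.
  rewrite !big_ord_recr /= addrC (es_lin _ _ _ (e_span M) (span M)).
  by rewrite es_e IH addrC.
move=> nN; rewrite sumE (bigD1 (Ordinal nN))//= eqxx mulr1 big1 ?addr0// => m.
by rewrite -val_eqE /= eq_sym => /negbTE ->; rewrite mulr0.
Qed.

(** At [s N], the partial sum of the series of [A z], the functional [es n] has
    the value [seq_f A n z] once [n < N], and it is bounded on the closed span,
    so that the value passes to the limit [A z].  That the remainder
    [A z - s N] lies in this span is clear because it is itself a value of [A]:
    the vectors [seq_x A m] are mapped to [e m]. *)
Lemma es_seqOp A n z : (forall z, closed_span e (A z)) ->
  es n (A z) = seq_f A n z.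
Proof.
move=> A_span; have [es_lin [M esM] _] := es_biorth n.
have [_ _ _ _ /(_ z) AE] := seq_assoc A.
pose s N := \sum_(m < N) (seq_f A m z : R) *: e m.
pose u N := \sum_(m < N) (seq_f A m z : R) *: seq_x A m.
have Au N : A (u N) = s N.
  by rewrite linear_sum; apply: eq_bigr => m _; rewrite linearZ/= seqOp_e.
apply/eqP; rewrite -subr_eq0 -normr_le0; apply/ler_addgt0Pl => eps eps0.
have K0 : 0 < `|M| + 1 by rewrite ltr_wpDl.
have /cvgrPdist_lt/(_ _ (divr_gt0 eps0 K0))[N0 _ sN] := AE.
pose N := maxn N0 n.+1.
have := sN N (leq_maxl _ _); rewrite /series /= big_mkord -/(s N).
rewrite ltr_pdivlMr// => sN_lt.
have s_es : es n (s N) = seq_f A n z.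
  by rewrite (es_sum (seq_f A ^~ z))// leq_maxr.
have diffE : A z - s N = A (- u N + z) by rewrite linearD linearN /= Au addrC.
have -> : es n (A z) - seq_f A n z = es n (A z - s N).
  have := es_lin (-1) (s N) (A z); rewrite s_es scaleN1r mulN1r addrC => ->//.
    by rewrite addrC.
  by rewrite -Au.
rewrite addr0 diffE (le_trans (esM _ (A_span _)))// -diffE.
rewrite (le_trans _ (ltW sN_lt))// mulrC ler_wpM2l//.
by rewrite (le_trans (ler_norm _))// lerDl.
Qed.

(** Membership in S_infty turns uniform convergence of the coordinates into
    convergence in norm. *)
Lemma seqOp_comp_null A T (S : boundedOp X X) :
    S_infty e es A -> negligible_product A T ->
  (fun n => A (S (seq_x T n))) @ \oo --> (0 : X).
Proof.
move=> [A_span A_S] AT; apply/norm_cvg0P; apply: A_S.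
  have [M _ xM] := seq_x_bounded T; exists (`|S| * M) => m.
  by rewrite (le_trans (opnorm_ub _ _))// ler_wpM2l// opnorm_ge0.
apply/cvgr0Pnorm_le => eps eps0.
apply: filterS (negligible_product_uniform S AT eps0) => n lt_eps.
have ub m : `|es m (A (S (seq_x T n)))| <= eps.
  by rewrite es_seqOp// ltW.
rewrite ger0_norm.
  apply: ge_sup => [|_ [m _ <-]]; last exact: ub.
  by exists `|es 0%N (A (S (seq_x T n)))|, 0%N.
apply: le_trans (ub_le_sup _ _); last by exists 0%N.
  exact: normr_ge0.
by exists eps => _ [m _ <-]; apply: ub.
Qed.

Lemma ideal_null (B : set (seqOp e)) T (P : boundedOp X X) :
    (forall A, B A -> S_infty e es A) ->
    (forall A, B A -> negligible_product A T) ->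
    (exists (l : nat) (Q A S : 'I_l -> boundedOp X X),
      [/\ (0 < l)%N, forall j, [set (seq_op A) | A in B] (A j)
        & P = \sum_(j < l) bop_comp (Q j) (bop_comp (A j) (S j))]) ->
  (fun n => P (seq_x T n)) @ \oo --> (0 : X).
Proof.
move=> BS BT [l [Q [A [S [_ BA ->]]]]].
under eq_fun do rewrite bop_sumE.
suff: (fun n => \sum_(j < l) Q j (A j (S j (seq_x T n)))) @ \oo -->
    \sum_(j < l) (0 : X) by rewrite big1.
apply: (cvg_big (@add_continuous X)) => j _ /=.
have [A' BA' <-] := BA j.
have A0 := seqOp_comp_null (S j) (BS _ BA') (BT _ BA').
apply/norm_cvg0P; apply/cvgr0Pnorm_lt => eps eps0.
have K0 : 0 < `|Q j| + 1 by rewrite ltr_wpDl.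
have /cvgr0Pnorm_lt/(_ _ (divr_gt0 eps0 K0)) := A0.
apply: filterS => n; rewrite ltr_pdivlMr// normr_id => /(le_lt_trans _); apply.
rewrite (le_trans (opnorm_ub _ _))// mulrC ler_wpM2l//.
by rewrite lerDl.
Qed.

End Coordinates.

Theorem proposition2p3 (R : realType) (X : completeNormedModType R)
    (e : nat -> X) (es : nat -> X -> R)
    (e_norm : normalized e) (e_basic : basic_sequence e)
    (es_biorth : biorthogonal_functionals e es)
    (T : seqOp e) (B : set (seqOp e))
    (B_neq0 : B !=set0)
    (B_S_infty : forall A : seqOp e, B A -> S_infty e es A)
    (B_inf : forall A : seqOp e, B A ->
      inf [set c_ k A * d_ k T / k%:R | k in [set k : nat | (0 < k)%N]] = 0)
    (Q : boundedOp X X)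
    (Q_ideal : closed_ideal [set (seq_op A) | A in B] Q) :
  1 / sup (range (fun n => `|seq_x T n|)) <= `|(T : boundedOp X X) - Q|.
Proof.
set d := sup _.
have x_d n : `|seq_x T n| <= d.
  have [M _ xM] := seq_x_bounded T.
  by apply: ub_le_sup; [exists M => _ [m _ <-]|exists n].
have d0 : 0 < d.
  have [_ _ _ [m [M [m0 /(_ 0%N)/andP[mx _]]]] _] := seq_assoc T.
  exact: lt_le_trans m0 (le_trans mx (x_d 0%N)).
rewrite div1r; apply/ler_addgt0Pl => eps eps0.
have [P [P_ideal QP]] := Q_ideal _ (nbhsx_ballx Q eps eps0).
have P0 := ideal_null es_biorth B_S_infty B_inf P_ideal.
have TP : `|(T : boundedOp X X) - P| <= eps + `|(T : boundedOp X X) - Q|.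
  have -> : (T : boundedOp X X) - P = (Q - P) + ((T : boundedOp X X) - Q).
    by rewrite [RHS]addrC subrKA.
  by rewrite (le_trans (ler_normD _ _))// lerD2r ltW.
apply: le_trans TP; rewrite -div1r ler_pdivrMr//.
apply/ler_addgt0Pl => eta eta0.
have /cvgr0Pnorm_lt/(_ _ eta0)[n _ /(_ _ (leqnn n)) Pn] := P0.
rewrite -(e_norm n) -(seqOp_e T n).
have -> : T (seq_x T n) =
    P (seq_x T n) + ((T : boundedOp X X) - P) (seq_x T n).
  by rewrite /= scaleN1r addrC subrK.
rewrite (le_trans (ler_normD _ _))// lerD ?(ltW Pn)//.
by rewrite (le_trans (opnorm_ub _ _))// ler_wpM2l// opnorm_ge0.
Qed.
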